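(* Suppose that for each customer $i\in\mathscr C$ all products have the same historical price, $P_{ij}=P_i$ for all $j\in\mathscr P$, and (without loss of generality) that customers are ordered so that $P_1\le P_2\le\dots\le P_m$. Then the price vector $\mathbf p^*$ defined by $p^*_j=P_{i^*}$ for all $j\in\mathscr P$, where $$i^*=\arg\max_{i\in\mathscr C}\{(m-i+1)P_i\},$$ is optimal to (OP-MIP).
   Context: There are customers $\mathscr C=\{1,\dots,m\}$ and products $\mathscr P=\{1,\dots,n\}$. Customer $i$ saw historical prices $P_{ij}>0$ and purchased product $c_i\in\mathscr P$. Let $P^{\max}=\max_iP_{ic_i}$. (OP-MIP): maximize $\sum_{i}\bar\tau_i$ over $\mathbf p\in\mathbb R^n_+$, $\boldsymbol\tau,\bar{\boldsymbol\tau}\in\mathbb R^m_+$, $\mathbf y\in\{0,1\}^{m\times n}$ subject to, for all $i\in\mathscr C$: $\tau_i\le p_j+(1-y_{ij})P_{ic_i}$ for all $j\in\mathscr P$; $p_{c_i}\le P_{ic_i}+(P^{\max}-P_{ic_i})(1-y_{ic_i})$; $p_j-p_{c_i}\ge P_{ij}-P_{ic_i}-(P^{\max}+P_{ij}-P_{ic_i})y_{ij}$ for all $j\ne c_i$; $\bar\tau_i\le y_{ic_i}P_{ic_i}$; $\bar\tau_i\le\tau_i$; $\bar\tau_i\ge\tau_i-(1-y_{ic_i})P_{ic_i}$. A price vector is optimal to (OP-MIP) if it is the $\mathbf p$-component of an optimal solution. *)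

(* Defs.v *)
From HB Require Import structures.
From mathcomp Require Import all_boot all_order all_algebra.

Set Implicit Arguments.
Unset Strict Implicit.
Unset Printing Implicit Defensive.

Import Order.TTheory GRing.Theory Num.Theory.

Local Open Scope ring_scope.

(* Customers are 'I_m and products are 'I_n, both numbered from 0.            *)

Record op_point (R : realFieldType) (m n : nat) := OpPoint {
  op_price : 'rV[R]_n;
  op_tau : 'rV[R]_m;
  op_taubar : 'rV[R]_m;
  op_y : 'M[bool]_(m, n) }.

(* As the prices are positive, the default value 0 is irrelevant for m > 0.   *)
Definition max_paid (R : realFieldType) (m n : nat)
    (P : 'M[R]_(m, n)) (c : 'I_m -> 'I_n) : R :=
  \big[Num.max/0]_(i < m) P i (c i).

Record op_feasible (R : realFieldType) (m n : nat)
    (P : 'M[R]_(m, n)) (c : 'I_m -> 'I_n) (s : op_point R m n) : Prop := {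
  op_price_ge0 : forall j, 0 <= op_price s 0 j;
  op_tau_ge0 : forall i, 0 <= op_tau s 0 i;
  op_taubar_ge0 : forall i, 0 <= op_taubar s 0 i;
  op_tau_le : forall i j,
    op_tau s 0 i <= op_price s 0 j + (1 - (op_y s i j)%:R) * P i (c i);
  op_paid_le : forall i,
    op_price s 0 (c i) <=
      P i (c i) + (max_paid P c - P i (c i)) * (1 - (op_y s i (c i))%:R);
  op_price_diff : forall i j, j != c i ->
    op_price s 0 j - op_price s 0 (c i) >=
      P i j - P i (c i) - (max_paid P c + P i j - P i (c i)) * (op_y s i j)%:R;
  op_taubar_le_paid : forall i,
    op_taubar s 0 i <= (op_y s i (c i))%:R * P i (c i);
  op_taubar_le_tau : forall i, op_taubar s 0 i <= op_tau s 0 i;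
  op_taubar_ge : forall i,
    op_taubar s 0 i >= op_tau s 0 i - (1 - (op_y s i (c i))%:R) * P i (c i) }.

Definition op_revenue (R : realFieldType) (m n : nat) (s : op_point R m n) : R :=
  \sum_(i < m) op_taubar s 0 i.

Definition op_optimal (R : realFieldType) (m n : nat)
    (P : 'M[R]_(m, n)) (c : 'I_m -> 'I_n) (s : op_point R m n) : Prop :=
  op_feasible P c s /\
  forall s' : op_point R m n, op_feasible P c s' -> op_revenue s' <= op_revenue s.

Definition op_optimal_price (R : realFieldType) (m n : nat)
    (P : 'M[R]_(m, n)) (c : 'I_m -> 'I_n) (p : 'rV[R]_n) : Prop :=
  exists2 s : op_point R m n, op_optimal P c s & op_price s = p.

(* Main.v *)
Require Import Defs.
From HB Require Import structures.
From mathcomp Require Import all_boot all_order all_algebra.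

(** When customer [i] saw one common price, a product [j] for which [y i j] is
    off must cost at least as much as the product [c i] that she bought, so
    the revenue [taubar i] is at most every price and not only the prices
    of the products selected by [y] ([taubar_le_price]).  Let [k] be the first
    customer served, that is with [y k (c k)] on.  The customers before [k]
    bring nothing, and each of the [m - k] others brings at most the price of
    [c k], which is at most [Pc k] since [k] is served.  Hence the revenue is
    at most [(m - k) * Pc k] for some [k] ([revenue_le_first_served]).
    Pricing everything at [Pc istar] and serving exactly the customers from
    [istar] on gives [(m - istar) * Pc istar] ([uniform_feasible],
    [uniform_revenue]), the largest of these bounds. *)

Set Implicit Arguments.
Unset Strict Implicit.
Unset Printing Implicit Defensive.

Import Order.TTheory GRing.Theory Num.Theory.

Local Open Scope ring_scope.

Lemma sumr_const_ord_ge (V : nmodType) (m k : nat) (x : V) :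
  \sum_(i < m | (k <= i)%N) x = x *+ (m - k).
Proof. by rewrite -(big_geq_mkord k m predT (fun=> x)) sumr_const_nat. Qed.

Lemma paid_le_max (R : realFieldType) (m n : nat) (P : 'M[R]_(m, n))
    (c : 'I_m -> 'I_n) (i : 'I_m) : P i (c i) <= max_paid P c.
Proof. exact: (le_bigmax 0 (fun k => P k (c k))). Qed.

(** If [y i j] is on, [tau i] is directly capped by the price of [j]; if it is
    off, the price of [j] is at least that of [c i], which caps [tau i] when
    customer [i] is served; otherwise [taubar i] vanishes. *)
Lemma taubar_le_price (R : realFieldType) (m n : nat) (P : 'M[R]_(m, n))
    (c : 'I_m -> 'I_n) (s : op_point R m n) (i : 'I_m) (j : 'I_n) :
    (forall j', P i j' = P i (c i)) -> op_feasible P c s ->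
  op_taubar s 0 i <= op_price s 0 j.
Proof.
move=> Pi_const fs.
have tau_on j' : op_y s i j' -> op_taubar s 0 i <= op_price s 0 j'.
  move=> yij; apply: le_trans (op_taubar_le_tau fs i) _.
  by have := op_tau_le fs i j'; rewrite yij subrr mul0r addr0.
have [yij|yij] := boolP (op_y s i j); first exact: tau_on.
have [yic|yic] := boolP (op_y s i (c i)); last first.
  apply: le_trans (op_price_ge0 fs j).
  by have := op_taubar_le_paid fs i; rewrite (negbTE yic) mul0r.
have j_neq_c : j != c i by apply: contraNneq yij => ->.
apply: le_trans (tau_on _ yic) _.
have := op_price_diff fs j_neq_c.
by rewrite (negbTE yij) mulr0 Pi_const subrr subr0 subr_ge0.
Qed.

(** The witness is the first customer served; the other alternative is that no
    customer is served. *)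
Lemma revenue_le_first_served (R : realFieldType) (m n : nat)
    (P : 'M[R]_(m, n)) (c : 'I_m -> 'I_n) (s : op_point R m n) :
    (forall i j, P i j = P i (c i)) -> op_feasible P c s ->
  op_revenue s <= 0 \/ exists k : 'I_m, op_revenue s <= (m - k)%:R * P k (c k).
Proof.
move=> P_const fs.
have unserved i : ~~ op_y s i (c i) -> op_taubar s 0 i <= 0.
  by move=> yic; have := op_taubar_le_paid fs i; rewrite (negbTE yic) mul0r.
have [k0 yk0|none] := pickP (fun i => op_y s i (c i)); last first.
  by left; apply: sumr_le0 => i _; apply: unserved; rewrite none.
right; case: (@arg_minnP _ k0 (fun i => op_y s i (c i)) val yk0) => k yk k_min.
exists k; rewrite mulr_natl -sumr_const_ord_ge [leRHS]big_mkcond /=.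
apply: ler_sum => i _; case: leqP => [_|lt_ik]; last first.
  by apply: unserved; apply/negP=> /k_min; rewrite leqNgt lt_ik.
apply: le_trans (taubar_le_price (c k) (P_const i) fs) _.
by have := op_paid_le fs k; rewrite yk subrr mulr0 addr0.
Qed.

(** Serving is decided by the rank of the customer and not by comparing prices,
    so that the revenue is exactly [m - k] times the price; a customer before
    [k] with the same historical price may be left unserved. *)
Definition uniform_point (R : realFieldType) (m n k : nat) (q : R) :
    op_point R m n :=
  OpPoint (\row_j q) (\row_i (if (k <= i)%N then q else 0))
    (\row_i (if (k <= i)%N then q else 0)) (\matrix_(i, j) (k <= i)%N).

Lemma uniform_revenue (R : realFieldType) (m n k : nat) (q : R) :
  op_revenue (uniform_point m n k q) = (m - k)%:R * q.
Proof.
rewrite mulr_natl -sumr_const_ord_ge [RHS]big_mkcond /=.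
by apply: eq_bigr => i _; rewrite mxE.
Qed.

Lemma uniform_feasible (R : realFieldType) (m n k : nat) (q : R)
    (P : 'M[R]_(m, n)) (c : 'I_m -> 'I_n) :
    (forall i j, 0 <= P i j) -> (forall i j, P i j = P i (c i)) ->
    0 <= q <= max_paid P c -> (forall i : 'I_m, (k <= i)%N -> q <= P i (c i)) ->
  op_feasible P c (uniform_point m n k q).
Proof.
move=> P_ge0 P_const /andP[q_ge0 q_le_max] q_le.
split=> [j|i|i|i j|i|i j _|i|i|i]; rewrite !mxE //; try by case: ifP.
- by case: leqP => _; rewrite ?subrr ?mul0r ?addr0 // subr0 mul1r addr_ge0.
- case: leqP => [/q_le le_qP|_]; first by rewrite subrr mulr0 addr0.
  by rewrite subr0 mulr1 addrC subrK.
- rewrite P_const addrK !subrr sub0r oppr_le0 mulr_ge0 ?ler0n //.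
  exact: le_trans q_le_max.
- by case: leqP => [/q_le|_]; rewrite ?mul1r ?mul0r.
- by rewrite gerBl mulr_ge0 // subr_ge0 lern1 leq_b1.
Qed.

(* MathComp world. With customers numbered from 0, the paper's m - i + 1      *)
(* becomes m - i; the natural subtraction is exact as i < m.                  *)
Theorem proposition7 (R : realFieldType) (m n : nat)
    (P : 'M[R]_(m, n)) (c : 'I_m -> 'I_n) (Pc : 'I_m -> R) (istar : 'I_m)
    (P_gt0 : forall i j, 0 < P i j)
    (P_const : forall i j, P i j = Pc i)
    (Pc_sorted : forall i k : 'I_m, (i <= k)%N -> Pc i <= Pc k)
    (istar_argmax : forall i : 'I_m,
       (m - i)%:R * Pc i <= (m - istar)%:R * Pc istar) :
  op_optimal_price P c (\row_(j < n) Pc istar).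
Proof.
have P_ge0 i j : 0 <= P i j by apply: ltW.
have P_row i j : P i j = P i (c i) by rewrite !P_const.
have Pc_ge0 i : 0 <= Pc i by rewrite -(P_const i (c i)).
exists (uniform_point m n istar (Pc istar)) => //; split.
  apply: uniform_feasible => // [|i /Pc_sorted]; last by rewrite P_const.
  by rewrite Pc_ge0 -(P_const istar (c istar)) paid_le_max.
move=> s fs; rewrite uniform_revenue.
case: (revenue_le_first_served P_row fs) => [le0|[k le_k]].
  by apply: le_trans le0 _; rewrite mulr_ge0.
by apply: le_trans le_k _; rewrite P_const.
Qed.
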